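(* Let $G$ be a graph with maximum degree $\Delta$ and minimum degree $\delta$, and let $r$ be a positive integer with $$2\leq r\leq \frac{\delta}{\log\big(2er(\Delta^2+1)\big)} .$$ Then $$\chi_r(G)\leq \chi(G)+(r-1)\left\lceil e\,\frac{\Delta}{\delta}\log\big(2er(\Delta^2+1)\big)\right\rceil .$$
   Context: Graphs are finite and simple. $\chi(G)$ is the chromatic number of $G$. For a positive integer $r$, an $r$-dynamic $k$-coloring of $G$ is a proper vertex coloring of $G$ with $k$ colors such that, for every vertex $v$, at least $\min\{r,\deg(v)\}$ different colors appear on the neighbors of $v$. The $r$-dynamic chromatic number $\chi_r(G)$ is the smallest $k$ such that $G$ has an $r$-dynamic $k$-coloring. $\log$ is the natural logarithm and $e$ is its base. *)

(* Defs.v *)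
From mathcomp Require Import all_boot all_order all_algebra.
From mathcomp Require Import all_reals all_analysis.

Set Implicit Arguments.
Unset Strict Implicit.
Unset Printing Implicit Defensive.

Record sgraph := SGraph {
  vertex :> finType;
  adj : rel vertex;
  adj_sym : symmetric adj;
  adj_irrefl : irreflexive adj
}.

Section Graph.
Variable G : sgraph.

Definition neighbors (v : G) : {set G} := [set u | adj v u].

Definition degree (v : G) : nat := #|neighbors v|.

Definition max_degree : nat := \max_(v : G) degree v.

(* The default #|G| exceeds every degree, so it never affects the minimum over
   a nonempty vertex set; the graph without vertices has minimum degree 0. *)
Definition min_degree : nat := \big[minn/#|G|]_(v : G) degree v.

Definition proper_coloring (k : nat) (c : {ffun G -> 'I_k}) : bool :=
  [forall u, forall v, adj u v ==> (c u != c v)].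

Definition dynamic_coloring (r k : nat) (c : {ffun G -> 'I_k}) : bool :=
  proper_coloring c &&
  [forall v, minn r (degree v) <= #|c @: neighbors v|].

Definition colorable (k : nat) : bool :=
  [exists c : {ffun G -> 'I_k}, proper_coloring c].

Definition dynamic_colorable (r k : nat) : bool :=
  [exists c : {ffun G -> 'I_k}, dynamic_coloring r c].

Lemma ex_dynamic_colorable (r : nat) : exists k, dynamic_colorable r k.
Proof.
exists #|G|; apply/existsP; exists [ffun v => enum_rank v].
have inj_c : injective [ffun v : G => enum_rank v].
  by move=> u v; rewrite !ffunE; apply: enum_rank_inj.
apply/andP; split; last first.
  by apply/forallP => v; rewrite card_imset // geq_minr.
apply/forallP => u; apply/forallP => v; apply/implyP => uv.
by apply: contraTneq uv => /inj_c ->; rewrite adj_irrefl.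
Qed.

Lemma ex_colorable : exists k, colorable k.
Proof.
have [k /existsP[c /andP[c_proper _]]] := ex_dynamic_colorable 0.
by exists k; apply/existsP; exists c.
Qed.

Definition chromatic_number : nat := ex_minn ex_colorable.

Definition dynamic_chromatic_number (r : nat) : nat :=
  ex_minn (ex_dynamic_colorable r).

End Graph.

(* Main.v *)
(** Give every vertex independently one of [r] labels: each of [r - 1] "new"
    labels with probability [L / delta], the "old" label otherwise.  By the
    Lovasz local lemma, with positive probability every vertex sees all [r]
    labels and sees every new label fewer than [k = ceil (e Delta L / delta)]
    times, where [L = log (2 e r (Delta^2 + 1))].  The vertices with a
    given new label then induce a graph of maximum degree less than [k], which
    is properly colored with [k] fresh colors; the vertices with the old label
    keep an optimal proper coloring. *)
Require Import Defs.
From mathcomp Require Import all_boot all_order all_algebra.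
From mathcomp Require Import all_reals all_analysis.
From mathcomp Require Import zify ring lra.

Set Implicit Arguments.
Unset Strict Implicit.
Unset Printing Implicit Defensive.

Import Order.TTheory GRing.Theory Num.Theory.
Local Open Scope ring_scope.

(** * Events on independent coordinates *)

Section ProductProbability.
Variables (R : realFieldType) (V C : finType) (w : C -> R).
Hypotheses (w_ge0 : forall c, 0 <= w c) (w_sum : \sum_c w c = 1).

Definition weight (f : {ffun V -> C}) : R := \prod_u w (f u).

Definition Pr (A : pred {ffun V -> C}) : R := \sum_(f | A f) weight f.

Definition depends_on (S : {set V}) (A : pred {ffun V -> C}) :=
  forall f g : {ffun V -> C}, {in S, f =1 g} -> A f = A g.

Lemma weight_ge0 f : 0 <= weight f.
Proof. by apply: prodr_ge0 => u _. Qed.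

(** Distributivity plays the part of independence. Taking [phi] to be 1, an indicator, or [t] on a
    single label yields the total mass and the two label estimates below. *)
Lemma sum_weight_prod (phi : V -> C -> R) :
  \sum_f weight f * \prod_u phi u (f u) = \prod_u \sum_c w c * phi u c.
Proof.
rewrite bigA_distr_bigA /=; apply: eq_bigr => f _.
by rewrite /weight -big_split.
Qed.

Lemma Pr_predT : Pr predT = 1.
Proof.
have := sum_weight_prod (fun _ _ => 1).
rewrite [RHS]big1 => [<-|u _].
  by apply: eq_bigr => f _; rewrite big1_eq mulr1.
by under eq_bigr do rewrite mulr1.
Qed.

Lemma Pr_sub (A B : pred {ffun V -> C}) : subpred A B -> Pr A <= Pr B.
Proof.
move=> AB; rewrite /Pr big_mkcond [leRHS]big_mkcond /=.
apply: ler_sum => f _; have := weight_ge0 f.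
by case: ifP => [/AB ->|_] //; case: ifP.
Qed.

Lemma Pr_ge0 A : 0 <= Pr A.
Proof. by apply: sumr_ge0 => f _; apply: weight_ge0. Qed.

Lemma Pr_union (A B : pred {ffun V -> C}) :
  Pr (predU A B) <= Pr A + Pr B.
Proof.
rewrite /Pr big_mkcond [X in _ <= X + _]big_mkcond [X in _ <= _ + X]big_mkcond.
rewrite -big_split; apply: ler_sum => f _ /=.
by have := weight_ge0 f; case: (A f); case: (B f) => /=; lra.
Qed.

Lemma Pr_exists (I : finType) (A : I -> pred {ffun V -> C}) :
  Pr (fun f => [exists i, A i f]) <= \sum_i Pr (A i).
Proof.
rewrite /Pr (exchange_big_dep xpredT) //= big_mkcond /=.
apply: ler_sum => f _; case: ifP => [/existsP[i Ai]|_].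
  rewrite (bigD1 i) //= lerDl; apply: sumr_ge0 => j _; exact: weight_ge0.
by apply: sumr_ge0 => j _; apply: weight_ge0.
Qed.

(* Exchanging the coordinates outside [S] of two independent samples is an
   involution that preserves the joint weight. *)
Lemma Pr_indep (S : {set V}) (A B : pred {ffun V -> C}) :
  depends_on S A -> depends_on (~: S) B ->
  Pr (predI A B) = Pr A * Pr B.
Proof.
move=> dA dB; pose mix (f g : {ffun V -> C}) :=
  [ffun u => if u \in S then f u else g u].
pose swap (fg : {ffun V -> C} * {ffun V -> C}) :=
  (mix fg.1 fg.2, mix fg.2 fg.1).
have swapK : involutive swap.
  move=> [f g]; rewrite /swap /=; congr pair; apply/ffunP => u;
  by rewrite !ffunE; case: (u \in S).
(* The extra factor [Pr predT] supplies the second independent sample. *)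
rewrite -[LHS]mulr1 -Pr_predT /Pr !big_distrlr /=.
rewrite !pair_big_dep /= (reindex_inj (inv_inj swapK)) /=.
apply: eq_big => [[f g]|[f g] _] /=.
  rewrite !andbT (dA _ f) ?(dB _ g) // => u; rewrite ?inE ffunE.
    by move/negPf->.
  by move->.
rewrite /weight -!big_split; apply: eq_bigr => u _ /=.
by rewrite !ffunE; case: (u \in S) => //; rewrite mulrC.
Qed.

(** * The symmetric Lovasz local lemma *)

Section LocalLemma.
Variables (I : finType) (A : I -> pred {ffun V -> C}) (S : I -> {set V}).
Variables (D : nat) (x : R).
Hypotheses (x_ge0 : 0 <= x) (x_lt1 : x < 1).
Hypothesis A_dep : forall i, depends_on (S i) (A i).

Definition dependency i : {set I} :=
  [set j | (j != i) && ~~ [disjoint S i & S j]].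

Hypothesis dependency_bound : forall i, (#|dependency i| <= D)%N.
Hypothesis A_bound : forall i, Pr (A i) <= x * (1 - x) ^+ D.

Definition avoid (T : {set I}) (f : {ffun V -> C}) :=
  [forall i in T, ~~ A i f].

Lemma avoid_setU1 i T f : avoid (i |: T) f = ~~ A i f && avoid T f.
Proof.
apply/forall_inP/andP => [H|[Hi /forall_inP HT] j].
  split; first by apply: H; rewrite setU11.
  by apply/forall_inP => j jT; apply: H; rewrite setU1r.
by case/setU1P => [->|/HT].
Qed.

Lemma Pr_avoid_setU1 i T :
  Pr (avoid (i |: T)) = Pr (avoid T) - Pr (predI (A i) (avoid T)).
Proof.
rewrite /Pr (bigID (A i) (avoid T)) /= addrAC.
under [X in _ = X - _ + _]eq_bigl do rewrite andbC.
rewrite subrr add0r; apply: eq_bigl => f.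
by rewrite avoid_setU1 andbC.
Qed.

(** Chain rule: each further event avoided keeps at least a fraction [1 - x] of the mass. The
    conditional bound is assumed only for sets smaller than [T :|: U], so that this lemma can serve
    inside the induction proving that bound. *)
Lemma Pr_avoid_extend (U T : {set I}) :
  (forall W : {set I}, (#|W| < #|T :|: U|)%N ->
     forall i, Pr (predI (A i) (avoid W)) <= x * Pr (avoid W)) ->
  (1 - x) ^+ #|U| * Pr (avoid T) <= Pr (avoid (T :|: U)).
Proof.
have [m] := ubnP #|U|; elim: m U => // m IH U ltUm cond.
have [->|[i iU]] := set_0Vmem U.
  by rewrite cards0 expr0 mul1r setU0.
have cardU : #|U| = #|U :\ i|.+1 by rewrite (cardsD1 i) iU.
rewrite cardU exprS -mulrA.
(* If [i] is already in [T], it adds no condition and its factor [1 - x <= 1] is dropped. *)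
have [iT|iT] := boolP (i \in T).
  have TU : T :|: U = T :|: (U :\ i).
    by apply/setP => j; rewrite !inE; case: eqP => [->|]; rewrite ?iT.
  rewrite TU; apply: le_trans (IH _ _ _); last 2 first.
  - by rewrite -ltnS -cardU.
  - by move=> W; rewrite -TU; apply: cond.
  rewrite ler_piMl ?gerBl // mulr_ge0 ?Pr_ge0 // exprn_ge0 // subr_ge0.
  exact: ltW.
have TU : T :|: U = i |: (T :|: (U :\ i)).
  by rewrite setUCA setD1K.
have lt_card : (#|T :|: (U :\ i)| < #|T :|: U|)%N.
  by rewrite TU cardsU1 !inE eqxx (negPf iT).
have := cond _ lt_card i; rewrite TU Pr_avoid_setU1 => cond_i.
have : (1 - x) ^+ #|U :\ i| * Pr (avoid T) <= Pr (avoid (T :|: (U :\ i))).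
  apply: IH; first by rewrite -ltnS -cardU.
  by move=> W ltW; apply: cond; apply: ltn_trans lt_card.
rewrite -(ler_pM2l (x := 1 - x)) ?subr_gt0 // => /le_trans; apply.
by lra.
Qed.

(** This bounds a conditional probability, multiplied out so that the condition may have probability
    0. Strong induction on the size of [T]. *)
Lemma Pr_conditional_bound (T : {set I}) i :
  Pr (predI (A i) (avoid T)) <= x * Pr (avoid T).
Proof.
have [m] := ubnP #|T|; elim: m T i => // m IH T i ltTm.
have [iT|iT] := boolP (i \in T).
  rewrite /Pr big_pred0 ?mulr_ge0 ?Pr_ge0 // => f /=.
  by apply/negP => /andP[Ai /forall_inP/(_ i iT)]; rewrite Ai.
(* [A i] is independent of avoiding [T2]. Restoring [T1], which has at most [D] elements, costs no
   more than the factor [(1 - x) ^+ D] provided by [A_bound]. *)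
set T1 := T :&: dependency i; set T2 := T :\: dependency i.
have T12 : T2 :|: T1 = T by rewrite setUC setID.
have dep2 : depends_on (~: S i) (avoid T2).
  move=> f g fg; apply: eq_forallb_in => j; rewrite !inE negb_and !negbK.
  case/andP => /orP[/eqP-> /(negP iT)//|dis] jT.
  congr negb; apply: A_dep => u uj; apply: fg.
  by rewrite inE (disjointFl dis uj).
have step : (1 - x) ^+ #|T1| * Pr (avoid T2) <= Pr (avoid T).
  rewrite -[in leRHS]T12; apply: Pr_avoid_extend; rewrite T12 => W ltW j.
  by apply: IH; apply: leq_trans ltW _; rewrite -ltnS.
apply: (@le_trans _ _ (Pr (predI (A i) (avoid T2)))).
  apply: Pr_sub => f /= /andP[-> /forall_inP aT]; apply/forall_inP => j.
  by case/setDP => jT _; apply: aT.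
rewrite (Pr_indep (@A_dep i) dep2).
apply: (@le_trans _ _ (x * ((1 - x) ^+ #|T1| * Pr (avoid T2)))); last first.
  by rewrite ler_wpM2l.
rewrite mulrA; apply: ler_wpM2r; first exact: Pr_ge0.
apply: le_trans (A_bound i) _; apply: ler_wpM2l => //.
apply: ler_wiXn2l; rewrite ?subr_ge0 ?gerBl ?(ltW x_lt1) //.
apply: leq_trans (dependency_bound i).
by apply: subset_leq_card; apply: subsetIr.
Qed.

Lemma lovasz_local_lemma : exists f : {ffun V -> C}, forall i, ~~ A i f.
Proof.
have avoid0 : Pr (avoid set0) = 1.
  rewrite -Pr_predT; apply: eq_bigl => f.
  by apply/forall_inP => i; rewrite inE.
(* Starting the chain from the empty set, all events are avoided with probability at least
   [(1 - x) ^+ #|I|], which is positive. *)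
have := @Pr_avoid_extend [set: I] set0 (fun W _ i => Pr_conditional_bound W i).
rewrite avoid0 mulr1 set0U => /(lt_le_trans _) => /(_ 0).
rewrite exprn_gt0 ?subr_gt0 // => /(_ isT) pos.
have [f /forall_inP af|none] := pickP (avoid [set: I]).
  by exists f => i; apply: af; rewrite inE.
by move: pos; rewrite /Pr big_pred0 // ltxx.
Qed.

End LocalLemma.

(** * Probabilities of missing and of frequent labels *)

Lemma prod_on_const (N : {set V}) (q : R) :
  \prod_u (if u \in N then q else 1) = q ^+ #|N|.
Proof. by rewrite -big_mkcond /= prodr_const. Qed.

Lemma Pr_missing (N : {set V}) (c : C) :
  Pr (fun f => c \notin f @: N) = (1 - w c) ^+ #|N|.
Proof.
rewrite -prod_on_const /Pr big_mkcond /=.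
(* The indicator of the event is a product over coordinates, so [sum_weight_prod] applies. *)
transitivity (\sum_f weight f *
    \prod_u (if u \in N then (f u != c)%:R else 1)).
  apply: eq_bigr => f _; case: ifP => [/imsetP nc|/negbFE/imsetP[u uN ->]].
    rewrite big1 ?mulr1 // => u _; case: ifP => // uN.
    by case: eqP => // fu; case: nc; exists u.
  by rewrite (bigD1 u) //= uN eqxx mul0r mulr0.
rewrite (sum_weight_prod
  (fun u a => if u \in N then (a != c)%:R else 1)) /=.
apply: eq_bigr => u _; case: ifP => _; last first.
  by under eq_bigr do rewrite mulr1.
rewrite -[X in X - _]w_sum [in RHS](bigD1 c) //= [X in X - _]addrC addrK.
rewrite [RHS]big_mkcond /=; apply: eq_bigr => a _.
by case: eqP; rewrite ?mulr0 ?mulr1.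
Qed.

(** Chernoff's method: Markov's inequality for [t] raised to the number of occurrences of [c], whose
    expectation factors over the coordinates. *)
Lemma Pr_frequent (N : {set V}) (c : C) (k : nat) (t : R) : 1 <= t ->
  t ^+ k * Pr (fun f => (k <= #|[set u in N | f u == c]|)%N)
  <= (1 + w c * (t - 1)) ^+ #|N|.
Proof.
move=> t_ge1; rewrite -prod_on_const /Pr big_distrr /= big_mkcond /=.
apply: (@le_trans _ _ (\sum_f weight f *
    \prod_u (if u \in N then (if f u == c then t else 1) else 1))).
  apply: ler_sum => f _.
  have -> : \prod_u (if u \in N then (if f u == c then t else 1) else 1) =
            t ^+ #|[set u in N | f u == c]|.
    rewrite -prod_on_const; apply: eq_bigr => u _.
    by rewrite !inE; case: (u \in N).
  have t_ge0 := le_trans ler01 t_ge1.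
  case: ifP => [le_k|_]; last by rewrite mulr_ge0 ?weight_ge0 ?exprn_ge0.
  by rewrite mulrC ler_wpM2l ?weight_ge0 // ler_weXn2l.
rewrite (sum_weight_prod
  (fun u a => if u \in N then (if a == c then t else 1) else 1)) /=.
rewrite le_eqVlt; apply/orP; left; apply/eqP.
apply: eq_bigr => u _; case: ifP => _; last first.
  by under eq_bigr do rewrite mulr1.
rewrite -[X in _ = X + _]w_sum (bigD1 c) //= [in RHS](bigD1 c) //= eqxx.
under eq_bigr => a /negPf-> do rewrite mulr1.
by ring.
Qed.

End ProductProbability.

(** * From labelings to dynamic colorings *)

Section Coloring.
Variable G : sgraph.

Lemma adj_proper (k : nat) (c : {ffun G -> 'I_k}) (u v : G) :
  proper_coloring c -> adj u v -> c u != c v.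
Proof. by move/forallP/(_ u)/forallP/(_ v)/implyP. Qed.

Lemma degree_le_max (v : G) : (degree v <= max_degree G)%N.
Proof. exact: (leq_bigmax v). Qed.

Lemma min_degree_le (v : G) : (min_degree G <= degree v)%N.
Proof.
rewrite /min_degree; have := mem_index_enum v.
elim: (index_enum _) => //= x s IH; rewrite big_cons inE.
case/orP => [/eqP <-|/IH]; first exact: geq_minl.
exact/leq_trans/geq_minr.
Qed.

(** Every such [u] ends a walk of length two from [v]. This will bound the dependency sets in the
    local lemma. *)
Lemma second_neighborhood_bound (v : G) :
  (#|[set u | ~~ [disjoint neighbors v & neighbors u]]| <= max_degree G ^ 2)%N.
Proof.
set B := \bigcup_(x in neighbors v) neighbors x.
apply: (@leq_trans #|B|).
  apply/subset_leq_card/subsetP => u; rewrite inE => /pred0Pn[x /andP[/= xv xu]].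
  by apply/bigcupP; exists x => //; move: xu; rewrite !inE adj_sym.
apply: (@leq_trans (\sum_(x in neighbors v) max_degree G)).
  rewrite /B; elim/big_rec2: _ => [|x m U _ leUm]; first by rewrite cards0.
  apply: leq_trans (leq_card_setU _ _) _.
  exact: leq_add (degree_le_max x) leUm.
by rewrite sum_nat_const leq_mul2r degree_le_max orbT.
Qed.

(** Induction on the size of [T]: a vertex put back sees at most [k] of the [k.+1] colors on its
    neighbors in [T]. Outside [T] the values of [c] are arbitrary. *)
Lemma greedy_coloring (k : nat) (T : {set G}) :
  (forall v, (#|neighbors v :&: T| <= k)%N) ->
  exists c : G -> 'I_k.+1,
    {in T &, forall u v, adj u v -> c u != c v}.
Proof.
have [m] := ubnP #|T|; elim: m T => // m IH T ltTm degT.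
have [->|[x xT]] := set_0Vmem T.
  by exists (fun=> ord0) => u v; rewrite inE.
have [|v|c c_proper] := IH (T :\ x).
- by move: ltTm; rewrite (cardsD1 x) xT.
- by apply: leq_trans (degT v); rewrite subset_leq_card ?setIS ?subD1set.
have [a fresh] : exists a, a \notin c @: (neighbors x :&: T).
  apply/existsP; rewrite -negb_forall; apply/negP => /forallP full.
  have := leq_trans (leq_imset_card c (neighbors x :&: T)) (degT x).
  suff -> : c @: (neighbors x :&: T) = setT by rewrite cardsT card_ord ltnn.
  by apply/setP => a; rewrite full inE.
have fresh_adj u : adj x u -> u \in T -> a != c u.
  move=> xu uT; apply: contraNneq fresh => ->.
  by apply: imset_f; rewrite !inE xu.
exists (fun v => if v == x then a else c v) => u v uT vT uv.
case: (eqVneq u x) => [ux|ux]; case: (eqVneq v x) => [vx|vx].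
- by move: uv; rewrite ux vx adj_irrefl.
- by apply: fresh_adj => //; rewrite -ux.
- by rewrite eq_sym; apply: fresh_adj => //; rewrite adj_sym -vx.
- by apply: c_proper => //; rewrite !inE ?ux ?vx.
Qed.

(** Allows a palette built as a disjoint sum of old colors and pairs of a new label with a fresh
    color. *)
Lemma dynamic_colorable_finType (K : finType) (r : nat) (c : G -> K) :
  (forall u v, adj u v -> c u != c v) ->
  (forall v, (minn r (degree v) <= #|c @: neighbors v|)%N) ->
  dynamic_colorable G r #|K|.
Proof.
move=> c_proper c_dyn; apply/existsP; exists [ffun v => enum_rank (c v)].
apply/andP; split.
  apply/forallP => u; apply/forallP => v; apply/implyP => uv.
  by rewrite !ffunE (inj_eq enum_rank_inj) c_proper.
apply/forallP => v; apply: leq_trans (c_dyn v) _.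
rewrite -(card_imset _ enum_rank_inj) -imset_comp.
by rewrite (eq_imset (g := [ffun v => enum_rank (c v)])) // => u; rewrite ffunE.
Qed.

Lemma dynamic_chromatic_number_le (r k : nat) :
  dynamic_colorable G r k -> (dynamic_chromatic_number G r <= k)%N.
Proof. by move=> Gk; rewrite /dynamic_chromatic_number; case: ex_minnP => m _; apply. Qed.

(* [None] is the label of the vertices that keep their old color. *)
Lemma dynamic_chromatic_number_labeling (n k : nat)
    (f : G -> option 'I_n) :
  (forall v c, c \in f @: neighbors v) ->
  (forall v i, (#|[set u in neighbors v | f u == Some i]| <= k)%N) ->
  (dynamic_chromatic_number G n.+1 <= chromatic_number G + n * k.+1)%N.
Proof.
move=> f_all f_few.
have [c0 c0_proper] : exists c : {ffun G -> 'I_(chromatic_number G)},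
    proper_coloring c.
  by apply/existsP; rewrite /chromatic_number; case: ex_minnP.
have /fin_all_exists[c1 c1_proper] (i : 'I_n) : exists c : G -> 'I_k.+1,
    {in [set u | f u == Some i] &, forall u v, adj u v -> c u != c v}.
  apply: greedy_coloring => v; apply: leq_trans (f_few v i).
  by apply/subset_leq_card/subsetP => u; rewrite !inE.
pose c v : 'I_(chromatic_number G) + 'I_n * 'I_k.+1 :=
  if f v is Some i then inr (i, c1 i v) else inl (c0 v).
have -> : (chromatic_number G + n * k.+1)%N =
    #|{: 'I_(chromatic_number G) + 'I_n * 'I_k.+1}|.
  by rewrite card_sum card_prod !card_ord.
apply/dynamic_chromatic_number_le/(@dynamic_colorable_finType _ _ c).
  move=> u v uv; rewrite /c.
  case fu: (f u) => [i|]; case fv: (f v) => [j|] //; last first.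
    by rewrite (inj_eq inl_inj) (adj_proper c0_proper).
  rewrite (inj_eq inr_inj) xpair_eqE negb_and.
  case: eqVneq => //= ij; rewrite -ij in fv *.
  by apply: c1_proper => //; rewrite inE ?fu ?fv.
(* A color determines its label and all [n.+1] labels occur around [v], so its neighbors carry at
   least [n.+1] colors. *)
move=> v; apply: leq_trans (geq_minl _ _) _.
pose label (a : 'I_(chromatic_number G) + 'I_n * 'I_k.+1) :=
  if a is inr b then Some b.1 else None.
apply: leq_trans (leq_imset_card label _); rewrite -imset_comp.
suff -> : (label \o c) @: neighbors v = setT.
  by rewrite cardsT card_option card_ord.
apply/setP => a; rewrite [RHS]inE.
rewrite (eq_imset (g := f)) ?f_all // => u.
by rewrite /label /c /=; case: (f u).
Qed.

End Coloring.

(** * The random labeling *)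

Section Labeling.
(** In the application [n] is [r - 1], [p] is [L / delta] and [k.+1] is the ceiling in the final
    bound. *)
Variables (R : realType) (G : sgraph) (n k : nat) (p L : R).
Hypotheses (p_ge0 : 0 <= p) (np_le1 : n.+1%:R * p <= 1).
Hypothesis max_degree_gt0 : (0 < max_degree G)%N.
Hypothesis L_le : L <= p * (min_degree G)%:R.
Hypothesis k_ge : expR 1 * (p * (max_degree G)%:R) <= k.+1%:R.
Hypothesis L_ge :
  (2 * n + 1)%:R * expR (- L) <= expR (- 1) / ((max_degree G)%:R ^+ 2 + 1).

Definition label_weight (c : option 'I_n) : R :=
  if c is Some _ then p else 1 - n%:R * p.

(** By [np_le1] the old label is no rarer than a new one, so a single estimate covers every missing
    label. *)
Lemma label_weight_ge c : p <= label_weight c.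
Proof. by case: c => //=; move: np_le1; rewrite -natr1 mulrDl; lra. Qed.

Lemma label_weight_sum : \sum_c label_weight c = 1.
Proof.
rewrite (bigD1 None) //= (eq_bigr (fun=> p)); last by case.
by rewrite sumr_const cardC1 card_option card_ord mulr_natl subrK.
Qed.

Lemma label_weight_le1 c : label_weight c <= 1.
Proof.
rewrite -label_weight_sum (bigD1 c) //= lerDl; apply: sumr_ge0 => a _.
exact: le_trans p_ge0 (label_weight_ge a).
Qed.

(** Each neighbor misses [c] with probability at most [1 - p <= exp (- p)], and [p] times the degree
    is at least [L]. *)
Lemma label_missing_bound (v : G) c :
  Pr label_weight (fun f => c \notin f @: neighbors v) <= expR (- L).
Proof.
rewrite (Pr_missing label_weight_sum).
apply: (@le_trans _ _ (expR (- p) ^+ degree v)).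
  rewrite lerXn2r ?nnegrE ?expR_ge0 ?subr_ge0 ?label_weight_le1 //.
  apply: le_trans (expR_ge1Dx _); rewrite lerD2l lerN2; exact: label_weight_ge.
rewrite -expRM_natl ler_expR mulrN lerN2 mulrC.
by apply: le_trans L_le _; rewrite ler_wpM2l // ler_nat min_degree_le.
Qed.

(** [Pr_frequent] with [t = e] gives the exponent [p (e - 1) Delta - (k + 1)]. It is at most [- L],
    since [k + 1 >= e p Delta] and [L <= p delta <= p Delta]. *)
Lemma label_frequent_bound (v : G) i :
  Pr label_weight
    (fun f => (k < #|[set u in neighbors v | f u == Some i]|)%N) <= expR (- L).
Proof.
have w_ge0 c := le_trans p_ge0 (label_weight_ge c).
have e_ge1 : 1 <= expR 1 :> R by rewrite -expR0 ler_expR.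
have /= := Pr_frequent w_ge0 label_weight_sum (neighbors v) (Some i) k.+1 e_ge1.
rewrite -expRM_natl mulr1 => bound.
rewrite -(ler_pM2l (expR_gt0 k.+1%:R)) -expRD.
apply: le_trans bound _.
apply: (@le_trans _ _ (expR (p * (expR 1 - 1)) ^+ degree v)).
  rewrite lerXn2r ?nnegrE ?expR_ge0 ?expR_ge1Dx //.
  by rewrite addr_ge0 // mulr_ge0 // subr_ge0.
rewrite -expRM_natl ler_expR.
have deg_le : (degree v)%:R <= (max_degree G)%:R :> R.
  by rewrite ler_nat degree_le_max.
have min_le : (min_degree G)%:R <= (max_degree G)%:R :> R.
  by rewrite ler_nat (leq_trans (min_degree_le v)) ?degree_le_max.
have pe_ge0 : 0 <= p * (expR 1 - 1) by rewrite mulr_ge0 ?subr_ge0.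
have := ler_wpM2l pe_ge0 deg_le; have := ler_wpM2l p_ge0 min_le.
by move: k_ge L_le; lra.
Qed.

Definition bad (v : G) (f : {ffun G -> option 'I_n}) :=
  [exists c, c \notin f @: neighbors v]
  || [exists i, (k < #|[set u in neighbors v | f u == Some i]|)%N].

Lemma bad_depends_on v : depends_on (neighbors v) (bad v).
Proof.
move=> f g fg; rewrite /bad; congr orb.
  by apply: eq_existsb => c; rewrite (eq_in_imset fg).
apply: eq_existsb => i; congr (_ < _)%N; apply: eq_card => u; rewrite !inE.
by case uv: (adj v u) => //=; rewrite fg // inE.
Qed.

(** Union bound over [n + 1] labels that may be missing and [n] new labels that may be too
    frequent. *)
Lemma Pr_bad v : Pr label_weight (bad v) <= (2 * n + 1)%:R * expR (- L).
Proof.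
have w_ge0 c := le_trans p_ge0 (label_weight_ge c).
have := Pr_union w_ge0 (fun f => [exists c, c \notin f @: neighbors v])
  (fun f => [exists i, (k < #|[set u in neighbors v | f u == Some i]|)%N]).
move/le_trans; apply.
apply: (@le_trans _ _ (n.+1%:R * expR (- L) + n%:R * expR (- L))); last first.
  by rewrite -mulrDl -natrD addSn addnn -mul2n addn1.
apply: lerD; apply: le_trans (Pr_exists w_ge0 _) _.
  have -> : n.+1%:R * expR (- L) = \sum_(c : option 'I_n) expR (- L).
    by rewrite sumr_const card_option card_ord mulr_natl.
  by apply: ler_sum => c _; apply: label_missing_bound.
have -> : n%:R * expR (- L) = \sum_(i < n) expR (- L).
  by rewrite sumr_const card_ord mulr_natl.
by apply: ler_sum => i _; apply: label_frequent_bound.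
Qed.

(** For positive [D] the right-hand side is the inverse of [(1 + 1 / D) ^ D], and
    [1 + 1 / D <= exp (1 / D)]. *)
Lemma expRN1_le (D : nat) : expR (- 1) <= (1 - (D%:R + 1)^-1) ^+ D :> R.
Proof.
case: D => [|D]; first by rewrite expr0 -[leRHS]expR0 ler_expR lerN10.
have D_gt0 : 0 < D.+1%:R :> R by rewrite ltr0n.
have -> : 1 - (D.+1%:R + 1)^-1 = (1 + D.+1%:R^-1)^-1 :> R.
  by field; rewrite !gt_eqF // ?addr_gt0 // addr_gt0.
have -> : expR (- 1) = (expR D.+1%:R^-1)^-1 ^+ D.+1 :> R.
  by rewrite -expRN -expRM_natl mulrN divff // gt_eqF.
rewrite lerXn2r ?nnegrE ?invr_ge0 ?expR_ge0 ?addr_ge0 ?invr_ge0 ?(ltW D_gt0) //.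
by rewrite lef_pV2 ?posrE ?expR_gt0 ?expR_ge1Dx ?addr_gt0 ?invr_gt0.
Qed.

Lemma good_labeling : exists f : {ffun G -> option 'I_n},
  (forall v c, c \in f @: neighbors v) /\
  (forall v i, (#|[set u in neighbors v | f u == Some i]| <= k)%N).
Proof.
have w_ge0 c := le_trans p_ge0 (label_weight_ge c).
(* For this [x], the local lemma's threshold [x (1 - x) ^ D] is at least [exp (- 1) / (D + 1)], the
   right-hand side of [L_ge]. *)
pose D := (max_degree G ^ 2)%N; pose x : R := (D%:R + 1)^-1.
have D1_gt0 : 0 < D%:R + 1 :> R by rewrite ltr_wpDl.
have [||v|v|f f_good] := @lovasz_local_lemma R G _ label_weight w_ge0
  label_weight_sum G bad (@neighbors G) D x _ _ bad_depends_on.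
- by rewrite invr_ge0 ltW.
- by rewrite invf_lt1 // ltrDr ltr0n expn_gt0 max_degree_gt0.
- apply: leq_trans (second_neighborhood_bound v).
  by apply/subset_leq_card/subsetP => u; rewrite !inE => /andP[].
- apply: le_trans (Pr_bad v) _; apply: le_trans L_ge _.
  rewrite -natrX mulrC ler_wpM2l ?invr_ge0 ?(ltW D1_gt0) //.
  exact: expRN1_le.
exists f; split => v c.
  apply: contraT => nc; case/negP: (f_good v); apply/orP; left.
  by apply/existsP; exists c.
rewrite leqNgt; apply/negP => lt_k; case/negP: (f_good v); apply/orP; right.
by apply/existsP; exists c.
Qed.

End Labeling.

(** * Choice of the parameters *)

Theorem theorem4 (R : realType) (G : sgraph) (r : nat)
    (Delta := max_degree G) (delta := min_degree G)
    (L := ln (2 * expR 1 * r%:R * (Delta%:R ^+ 2 + 1)) : R) :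
  (2 <= r)%N ->
  r%:R <= delta%:R / L ->
  (dynamic_chromatic_number G r)%:Z <=
    (chromatic_number G)%:Z
    + (r%:Z - 1) * Num.ceil (expR 1 * (Delta%:R / delta%:R) * L).
Proof.
case: r @L => // n L n_gt0 r_le.
have n1_gt0 : 0 < n.+1%:R :> R by rewrite ltr0n.
have delta_gt0 : 0 < delta%:R :> R.
  rewrite ltr0n lt0n; apply: contraTneq r_le => ->.
  by rewrite mul0r -ltNge.
(* If [L <= 0] then [delta / L <= 0 < r]; this includes [L = 0], where the quotient is 0 by
   convention. *)
have L_gt0 : 0 < L.
  rewrite ltNge; apply: contraTN r_le => L_le0; rewrite -ltNge.
  by apply: le_lt_trans n1_gt0; rewrite mulr_ge0_le0 ?invr_le0 // ltW.
have Delta_gt0 : 0 < Delta%:R :> R.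
  have [v _|G0] := pickP G.
    apply: lt_le_trans delta_gt0 _.
    by rewrite ler_nat (leq_trans (min_degree_le v)) ?degree_le_max.
  (* Without vertices the minimum degree takes its default [#|G|], here 0. *)
  move: delta_gt0; rewrite /delta /min_degree big_pred0 //.
  by rewrite (eq_card0 G0) ltxx.
set K := Num.ceil _.
have K_gt0 : 0 < K by rewrite ceil_gt0 mulr_gt0 ?mulr_gt0 ?expR_gt0 ?invr_gt0.
(* With [K = k + 1], fewer than [K] occurrences means at most [k], the form used in
   [good_labeling]. *)
have [k Kk] : exists k : nat, K = k.+1%:Z by exists `|K|%N.-1; lia.
have [||||||f [f_all f_few]] :=
    @good_labeling R G n k (L / delta%:R) L.
- by rewrite mulr_ge0 ?invr_ge0 ?ltW.
(* This is exactly the upper bound assumed on [r]. *)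
- by rewrite mulrA ler_pdivrMr // mul1r -ler_pdivlMr.
- by rewrite -(ltr0n R).
- by rewrite mulfVK // gt_eqF.
- have := @ceil_ge R (expR 1 * (Delta%:R / delta%:R) * L).
  by rewrite -/K Kk; congr (_ <= _); ring.
(* As [exp (- L)] is the inverse of [2 e r (Delta^2 + 1)], the claim reduces to
   [2 n + 1 <= 2 (n + 1)]. *)
- rewrite expRN lnK; last first.
    by rewrite posrE !mulr_gt0 ?expR_gt0 // addr_gt0 // exprn_gt0.
  have e_gt0 := expR_gt0 (1 : R).
  have D_gt0 : 0 < Delta%:R ^+ 2 + 1 :> R by rewrite addr_gt0 // exprn_gt0.
  rewrite expRN -/Delta.
  have -> : (2 * expR 1 * n.+1%:R * (Delta%:R ^+ 2 + 1))^-1 =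
      (expR 1)^-1 / (Delta%:R ^+ 2 + 1) * (2 * n.+1)%:R^-1 :> R.
    by rewrite natrM; field; rewrite !gt_eqF.
  rewrite mulrCA ler_piMr //.
  by rewrite ler_pdivrMr ?ltr0n // mul1r ler_nat; lia.
have := dynamic_chromatic_number_labeling f_all f_few.
rewrite Kk; nia.
Qed.
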